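(* Let $G$ be a finite group such that for every non-central conjugacy class $K$ of $G$ there is a conjugacy class $D$ of $G$ with $K^2=\{1\}\cup D$. Then $G/\mathbf{F}(G)$ is an elementary abelian $2$-group.
   Context: For a subset $K\subseteq G$, $K^2=\{ab : a,b\in K\}$. A conjugacy class of $G$ is central if it is contained in the center $\mathbf{Z}(G)$ (equivalently, it has exactly one element), and non-central otherwise. $\mathbf{F}(G)$ is the Fitting subgroup of $G$ (the largest nilpotent normal subgroup). The trivial group counts as an elementary abelian $2$-group. *)

(* Defs.v *)
From mathcomp Require Import all_boot all_fingroup all_solvable.

(* Main.v *)
Require Import Defs.
From mathcomp Require Import all_boot all_fingroup all_solvable.

(** It suffices to show that [x ^+ 2] lies in the Fitting subgroup for every
    [x] in [G], since a group of exponent dividing 2 is elementary abelian.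
    This is clear when [x ^+ 2] is central. Otherwise let [K] and [D] be the
    classes of [x] and [x ^+ 2]: both are non-central, so [K * K = 1 |: D] and
    [D * D = 1 |: E] for some class [E], which is equal to or disjoint from [D].
    - If [D] and [E] are disjoint, then [K] has at most two elements
      ([card_sqr_disjoint]): a translate of [K] lies in [1 |: D] and, up to one
      element, in [1 |: E]. As [1] is in [K * K], the class [K] is closed under
      inverses, so [K] consists of [x] and [x^-1], and [<[x]>] is a normal cyclic
      subgroup; hence [x] is in the Fitting subgroup ([class_small_Fitting]).
    - If [D = E], then [1 |: D] is a normal subgroup whose nontrivial elements
      are all conjugate in [G]. They have the same order, a prime [p] by
      Cauchy's theorem, so this subgroup is a [p]-group, hence nilpotent, and
      it contains [x ^+ 2] ([sqr_class_idem_Fitting]). *)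

Set Implicit Arguments.
Unset Strict Implicit.
Unset Printing Implicit Defensive.

Local Open Scope group_scope.

(** Pick [s = a * b] in [D]. Then [a *: K] lies in [1 |: D], and
    [a * c = s * (b^-1 * c)] with [b^-1 * c] in [K * K = 1 |: D] shows that it
    also lies in [s |: (1 |: E)]; disjointness leaves only [1] and [s]. *)
Lemma card_sqr_disjoint (gT : finGroupType) (K D E : {set gT}) (s : gT) :
    {in K, forall y, y^-1 \in K} -> K * K = 1 |: D -> D * D = 1 |: E ->
    [disjoint D & E] -> s \in D ->
  #|K| <= 2.
Proof.
move=> KV KK DD disDE Ds.
have: s \in K * K by rewrite KK setU1r.
case/mulsgP=> a b Ka Kb def_s.
suffices sub: a *: K \subset [set 1; s].
  rewrite -(card_lcoset K a) (leq_trans (subset_leq_card sub)) //.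
  by rewrite cards2 ltnS leq_b1.
apply/subsetP=> _ /lcosetP[c Kc ->]; rewrite !inE.
have: a * c \in 1 |: D by rewrite -KK mem_mulg.
rewrite !inE => /orP[-> // | Dac].
have: b^-1 * c \in 1 |: D by rewrite -KK mem_mulg ?KV.
have ->: a * c = s * (b^-1 * c) by rewrite def_s -mulgA mulKVg.
rewrite !inE => /orP[/eqP-> | Dbc]; first by rewrite mulg1 eqxx orbT.
have: s * (b^-1 * c) \in 1 |: E by rewrite -DD mem_mulg.
rewrite !inE => /orP[-> // |].
have ->: s * (b^-1 * c) = a * c by rewrite def_s -mulgA mulKVg.
by rewrite (disjointFr disDE Dac).
Qed.

(** By Cauchy's theorem [n] is the only prime that can divide [#|H|]. *)
Lemma same_order_nil (gT : finGroupType) (H : {group gT}) n :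
  {in H^#, forall x, #[x] = n} -> nilpotent H.
Proof.
move=> oH; apply: (@pgroup_nil _ n); apply/pgroupP=> q q_pr.
case/(Cauchy q_pr)=> x Hx ox; rewrite inE /= -ox oH // !inE Hx andbT.
by rewrite -order_eq1 ox neq_ltn prime_gt1 ?orbT.
Qed.

(** The hypothesis makes [1 |: y ^: G] a normal subgroup in which all nontrivial
    elements are conjugate in [G], so that [same_order_nil] applies. *)
Lemma sqr_class_idem_Fitting (gT : finGroupType) (G : {group gT}) (y : gT) :
  y \in G -> y ^: G * y ^: G = 1 |: y ^: G -> y \in 'F(G).
Proof.
move=> Gy DD; set D := y ^: G in DD.
have sDG: D \subset G by rewrite class_subG.
have gT1: group_set (1 |: D).
  apply/group_setP; split=> [|u v]; first exact: setU11.
  rewrite !inE => /orP[/eqP-> | Du]; first by rewrite mul1g.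
  case/orP=> [/eqP-> | Dv]; first by rewrite mulg1 Du orbT.
  by rewrite -in_setU1 -DD mem_mulg.
pose T := group gT1.
have nTG: T <| G.
  rewrite /normal subUset sub1G sDG /=.
  by apply: subset_trans (normsU (norms1 G) (class_norm y G)).
have nilT: nilpotent T.
  apply: (@same_order_nil _ _ #[y]) => t; rewrite !inE.
  by case/andP=> /negPf-> /= /imsetP[g _ ->]; rewrite orderJ.
by apply: (subsetP (Fitting_max nTG nilT)); rewrite inE class_refl orbT.
Qed.

(** Here [x ^: G] is [[set x; x^-1]], so [<[x]>] is normal in [G]. *)
Lemma class_small_Fitting (gT : finGroupType) (G : {group gT}) (x : gT) :
    x \in G -> x^-1 \in x ^: G -> x ^+ 2 != 1 -> #|x ^: G| <= 2 ->
  x \in 'F(G).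
Proof.
move=> Gx KxV x2 leK2.
have neq: x != x^-1 by rewrite -(inj_eq (mulgI x)) mulgV -expg2.
have defK: [set x; x^-1] = x ^: G.
  apply/eqP; rewrite eqEcard cards2 neq leK2 andbT.
  by apply/subsetP=> _ /set2P[]->; rewrite ?class_refl.
have nXG: <[x]> <| G.
  rewrite /normal cycle_subG Gx; apply/normsP=> g Gg.
  apply/eqP; rewrite eqEcard cardJg leqnn andbT -cycleJ cycle_subG.
  have: x ^ g \in x ^: G by rewrite memJ_class.
  by rewrite -defK => /set2P[]->; rewrite ?groupV cycle_id.
by rewrite -cycle_subG Fitting_max ?abelian_nil ?cycle_abelian.
Qed.

Theorem corollaryC (gT : finGroupType) (G : {group gT}) :
  (forall K : {set gT}, K \in classes G -> ~~ (K \subset 'Z(G)) ->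
     exists2 D : {set gT}, D \in classes G & K * K = 1 |: D) ->
  2.-abelem (G / 'F(G)).
Proof.
move=> sqG; suffices sqF x: x \in G -> x ^+ 2 \in 'F(G).
  apply/exponent2_abelem/exponentP=> _ /morphimP[x Nx Gx ->].
  by rewrite -morphX //; apply/coset_id/sqF.
move=> Gx; have [Zx2 | nZx2] := boolP (x ^+ 2 \in 'Z(G)).
  apply: subsetP Zx2; rewrite Fitting_max ?center_normal //.
  by rewrite abelian_nil ?center_abelian.
have nZx: x \notin 'Z(G) by apply: contra nZx2 => Zx; rewrite groupX.
have x2n1: x ^+ 2 != 1 by apply: contraNneq nZx2 => ->.
have nZclass y: y \notin 'Z(G) -> ~~ (y ^: G \subset 'Z(G)).
  by apply: contra => /subsetP; apply; apply: class_refl.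
have [_ /imsetP[d Gd ->] KK] := sqG _ (mem_classes Gx) (nZclass _ nZx).
(* The second class is that of [x ^+ 2], a nontrivial element of [K * K]. *)
have eqD: d ^: G = x ^+ 2 ^: G.
  apply/class_eqP; rewrite class_sym.
  have: x * x \in 1 |: d ^: G by rewrite -KK mem_mulg ?class_refl.
  by rewrite -expg2 !inE (negPf x2n1) class_sym.
rewrite {d Gd}eqD in KK.
have [_ /imsetP[e Ge ->] DD] :=
  sqG _ (mem_classes (groupX 2 Gx)) (nZclass _ nZx2).
have [De | nDe] := boolP (e \in x ^+ 2 ^: G).
  by rewrite sqr_class_idem_Fitting ?groupX // DD (class_eqP De).
have disDE: [disjoint x ^+ 2 ^: G & e ^: G].
  apply/pred0P=> z /=; apply: contraNF nDe => /andP[Dz Ez].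
  by rewrite -(class_eqP Dz) class_sym.
have KxV: x^-1 \in x ^: G.
  have: 1 \in x ^: G * x ^: G by rewrite KK setU11.
  case/mulsgP=> u v Ku Kv /esym/eqP; rewrite -eq_invg_mul => /eqP uV.
  case/imsetP: Ku uV => g Gg -> xgV.
  rewrite -[x^-1](conjgK g) conjVg xgV memJ_norm //.
  by rewrite groupV (subsetP (class_norm _ _)).
have KV: {in x ^: G, forall y, y^-1 \in x ^: G}.
  move=> _ /imsetP[g Gg ->].
  by rewrite -conjVg memJ_norm // (subsetP (class_norm _ _)).
rewrite groupX // class_small_Fitting //.
exact: card_sqr_disjoint KV KK DD disDE (class_refl _ _).
Qed.
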